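(* For every weighted digraph $\Gamma$ with Kirchhoff matrix $L$ and normalized matrix of maximum out forests $\bar J$, and for any real $\alpha\neq 0$, the group inverse $L^{\#}$ of $L$ exists and is given by $$L^{\#}=(L+\alpha\bar J)^{-1}-\alpha^{-1}\bar J,$$ and moreover $$L^{\#}L=LL^{\#}=I-\bar J.$$
   Context: $\Gamma$ is a weighted digraph without loops with vertex set $\{1,\dots,n\}$, $n>1$; all arcs have strictly positive real weights; $\varepsilon_{ij}$ denotes the weight of the arc from $i$ to $j$, with $\varepsilon_{ij}=0$ if and only if there is no such arc. The Kirchhoff matrix $L=(\ell_{ij})$ is the $n\times n$ matrix with $\ell_{ij}=-\varepsilon_{ji}$ for $j\ne i$ and $\ell_{ii}=-\sum_{k\ne i}\ell_{ik}$. A diverging forest is a digraph without (directed) circuits in which every vertex has indegree at most 1; its weak components are diverging trees, each having a unique vertex of indegree 0 (its root) from which all vertices of the tree are reachable. An out forest of $\Gamma$ is a spanning subgraph of $\Gamma$ that is a diverging forest; a maximum out forest is an out forest with the greatest possible number of arcs. The out forest dimension $v$ is the number of weak components of any maximum out forest, so maximum out forests have $n-v$ arcs. The weight of a subgraph is the product of the weights of its arcs (1 if it has no arcs); the weight $\varepsilon(\mathcal G)$ of a set of subgraphs is the sum of the weights of its elements (0 for the empty set). The normalized matrix of maximum out forests is $\bar J=(\bar J_{ij})$ with $\bar J_{ij}=\varepsilon(\mathcal F_{n-v}^{j\to i})/\varepsilon(\mathcal F_{n-v})$, where $\mathcal F_{n-v}$ is the set of maximum out forests and $\mathcal F_{n-v}^{j\to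 i}$ is the set of those in which $i$ belongs to a tree with root $j$. The group inverse of a square matrix $A$ is the (unique if it exists) matrix $X=A^{\#}$ such that $AXA=A$, $XAX=X$ and $AX=XA$. *)

(* Defs.v *)
From HB Require Import structures.
From mathcomp Require Import all_boot all_order all_algebra.

Set Implicit Arguments.
Unset Strict Implicit.
Unset Printing Implicit Defensive.

Import Order.TTheory GRing.Theory Num.Theory.
Local Open Scope ring_scope.

(* The vertex set {1, ..., n} is encoded as 'I_n. [weight G i j] is the weight
   of the arc from i to j; it is positive exactly when that arc is present. *)
Record wdigraph (R : realFieldType) (n : nat) := WDigraph {
  weight : 'I_n -> 'I_n -> R;
  weight_ge0 : forall i j, 0 <= weight i j;
  weight_noloop : forall i, weight i i = 0
}.

(* A spanning (sub)digraph on 'I_n is given by its arc set; the pair (i, j) is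
   the arc from i to j. *)
Section ArcSets.
Variable n : nat.
Implicit Types (F : {set 'I_n * 'I_n}) (T : {set 'I_n}).

Definition arc_rel F : rel 'I_n := [rel i j | (i, j) \in F].

Definition indegree F (j : 'I_n) : nat := #|[set i | (i, j) \in F]|.

(* The vertices of a circuit are pairwise distinct, so its length k.+1 is at
   most n. *)
Definition has_circuit F : bool :=
  [exists k : 'I_n, exists c : k.+1.-tuple 'I_n,
     cycle (arc_rel F) c && uniq c].

Definition diverging_forest F : bool :=
  ~~ has_circuit F && [forall j, indegree F j <= 1]%N.

Definition weak_component F (i : 'I_n) : {set 'I_n} :=
  [set k | connect [rel x y | arc_rel F x y || arc_rel F y x] i k].

Definition is_root F T (j : 'I_n) : bool :=
  [&& j \in T, indegree F j == 0%N
    & [forall k in T, connect (arc_rel F) j k]].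

End ArcSets.

Section Forests.
Variables (R : realFieldType) (n : nat) (G : wdigraph R n).

Definition arcs : {set 'I_n * 'I_n} := [set a | weight G a.1 a.2 != 0].

Definition out_forests : {set {set 'I_n * 'I_n}} :=
  [set F : {set 'I_n * 'I_n} | (F \subset arcs) && diverging_forest F].

Definition max_out_forests : {set {set 'I_n * 'I_n}} :=
  [set F in out_forests | [forall H in out_forests, #|H| <= #|F|]%N].

(* The maximum out forests in which i belongs to a tree with root j. *)
Definition max_out_forests_from_to (j i : 'I_n) : {set {set 'I_n * 'I_n}} :=
  [set F in max_out_forests | is_root F (weak_component F i) j].

Definition subgraph_weight (F : {set 'I_n * 'I_n}) : R :=
  \prod_(a in F) weight G a.1 a.2.

Definition set_weight (S : {set {set 'I_n * 'I_n}}) : R :=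
  \sum_(F in S) subgraph_weight F.

Definition Jbar : 'M[R]_n :=
  \matrix_(i, j) (set_weight (max_out_forests_from_to j i)
                    / set_weight max_out_forests).

Definition kirchhoff : 'M[R]_n :=
  \matrix_(i, j) (if j != i then - weight G j i
                  else - \sum_(k | k != i) (- weight G k i)).

End Forests.

Definition is_group_inverse (R : realFieldType) (n : nat) (A X : 'M[R]_n) : Prop :=
  [/\ A *m X *m A = A, X *m A *m X = X & A *m X = X *m A].

(* Main.v *)
(* Let [Q_k] be the matrix whose entry (i, j) is the total weight of the k-arc
   forests in which i lies in the tree rooted at j, and [s_k] the total weight
   of all k-arc forests. Then [Q_(k+1) = s_(k+1) I - L Q_k]: expanding [L Q_k]
   as a sum over arcs (m, i) and k-arc forests F, the terms where i is a root of
   F and m lies outside its tree correspond to the (k+1)-arc forests F + (m, i);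
   those where i is not a root cancel in pairs under exchange of the arc of F
   into i with (m, i); all others vanish.
   Hence each [Q_k] is a polynomial in L. If d is the size of a maximum forest,
   then [s_(d+1)] and [Q_(d+1)] vanish, so [Jbar = Q_d / s_d] is annihilated by L
   on both sides and [I - Jbar] is L times a matrix commuting with L; so [Jbar]
   is the projection complementary to L. *)

Require Import Defs.
From HB Require Import structures.
From mathcomp Require Import all_boot all_order all_algebra.

Set Implicit Arguments.
Unset Strict Implicit.
Unset Printing Implicit Defensive.

Import Order.TTheory GRing.Theory Num.Theory.
Local Open Scope ring_scope.

Lemma connect_closed_ind (T : finType) (e : rel T) (P : T -> Prop) (x y : T) :
  (forall u v, e u v -> P u -> P v) -> P x -> connect e x y -> P y.
Proof.
move=> eP Px /connectP[p]; elim: p x Px => [|z p IHp] x Px /=; first by move=> _ ->.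
by case/andP=> /eP/(_ Px); apply: IHp.
Qed.

(** * Circuits, indegrees and reachability in arc sets *)

Section ArcSets.
Variable n : nat.
Implicit Types (F : {set 'I_n * 'I_n}) (i j m x y : 'I_n).

Lemma arc_relE F x y : arc_rel F x y = ((x, y) \in F).
Proof. by []. Qed.

Lemma has_circuitP F :
  reflect (exists x y, (x, y) \in F /\ connect (arc_rel F) y x) (has_circuit F).
Proof.
apply: (iffP existsP) => [[k /existsP[c /andP[]]]|[x [y [Fxy]]]].
  case: c => [[|y p] //= _]; rewrite rcons_path => /andP[py Fy] _.
  by exists (last y p), y; split => //; apply/connectP; exists p.
(* Shortening the return path makes its vertices distinct. This bounds its length, so the circuit
   fits the encoding in [has_circuit]. *)
case/connectP=> p0 py0 x_last; case: (shortenP py0) x_last => p py Up _ x_last.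
have lt_p : (size p < n)%N.
  by have := max_card (mem (y :: p)); rewrite card_ord (card_uniqP Up).
have szp : size (y :: p) == (Ordinal lt_p).+1 by [].
exists (Ordinal lt_p); apply/existsP; exists (Tuple szp).
by rewrite Up andbT /= rcons_path py -x_last.
Qed.

Lemma indegree_eq0P F j :
  reflect (forall x, (x, j) \notin F) (indegree F j == 0%N).
Proof.
rewrite /indegree cards_eq0; apply: (iffP eqP) => [E x | H].
  by apply/negP => Fx; have := in_set0 x; rewrite -E inE Fx.
by apply/setP => x; rewrite !inE (negPf (H x)).
Qed.

Lemma indegree_neq0P F j :
  reflect (exists x, (x, j) \in F) (indegree F j != 0%N).
Proof.
apply: (iffP idP) => [|[x Fx]].
  by rewrite /indegree cards_eq0 => /set0Pn[x]; rewrite inE; exists x.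
by apply/negP => /indegree_eq0P/(_ x); rewrite Fx.
Qed.

Lemma diverging_forestP F :
  reflect ((forall x y, (x, y) \in F -> ~~ connect (arc_rel F) y x)
           /\ (forall x y j, (x, j) \in F -> (y, j) \in F -> x = y))
          (diverging_forest F).
Proof.
apply: (iffP andP) => [[/has_circuitP acF /forallP indF] | [acF indF]]; split.
- by move=> x y Fxy; apply/negP => Fyx; apply: acF; exists x, y.
- move=> x y j Fx Fy; have /card_le1P/(_ x) := indF j.
  by rewrite inE => /(_ Fx)/(_ y); rewrite !inE Fy => /esym/eqP.
- by apply/has_circuitP => -[x [y [/acF/negPf->]]].
apply/forallP => j; apply/card_le1_eqP => x y; rewrite !inE => Fx Fy; exact: indF Fy Fx.
Qed.

Lemma connect_lastP F x y :
  connect (arc_rel F) x y ->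
  x = y \/ exists2 z, (z, y) \in F & connect (arc_rel F) x z.
Proof.
case/connectP; case/lastP => [|p z]; first by move=> _ ->; left.
rewrite rcons_path last_rcons => /andP[px Fz] ->; right.
by exists (last x p) => //; apply/connectP; exists p.
Qed.

Lemma connect_to_source F x j :
  indegree F j == 0%N -> connect (arc_rel F) x j -> x = j.
Proof.
by move=> /indegree_eq0P j0 /connect_lastP[// | [z]]; rewrite (negPf (j0 z)).
Qed.

(** Avoids weak components; by [is_rootE] it agrees with [is_root] on forests. *)
Definition tree_root F i j := (indegree F j == 0%N) && connect (arc_rel F) j i.

Lemma tree_root_source F i j : indegree F i == 0%N -> tree_root F i j = (j == i).
Proof.
move=> i0; apply/andP/eqP => [[_ /(connect_to_source i0)] // | ->].
by rewrite connect0.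
Qed.

(** * Roots in a diverging forest *)

Section Forest.
Variable F : {set 'I_n * 'I_n}.
Hypothesis forF : diverging_forest F.

(** Indegrees at most 1 leave only one way to walk backwards from [x], and both [a] and [b] lie on
    that walk. *)
Lemma ancestors_comparable a b x :
  connect (arc_rel F) a x -> connect (arc_rel F) b x ->
  connect (arc_rel F) a b \/ connect (arc_rel F) b a.
Proof.
have [_ indF] := diverging_forestP _ forF.
move=> ax bx; pose P y := connect (arc_rel F) a y \/ connect (arc_rel F) y a.
suff Pclosed: forall u v, (u, v) \in F -> P v -> P u.
  have bxr : connect [rel u v | arc_rel F v u] x b by rewrite connect_rev.
  apply: (@connect_closed_ind _ _ P x b _ _ bxr); last by left.
  by move=> u v; exact: Pclosed.
move=> u v Fuv; rewrite /P => -[av|va].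
  case: (connect_lastP av) => [->|[z Fz az]]; first by right; exact: connect1.
  by left; rewrite (indF _ _ _ Fuv Fz).
by right; apply: connect_trans va; exact: connect1.
Qed.

Lemma tree_root_uniq i j k : tree_root F i j -> tree_root F i k -> j = k.
Proof.
case/andP=> j0 ji /andP[k0 ki]; have [] := ancestors_comparable ji ki.
  exact: connect_to_source.
by move/(connect_to_source j0).
Qed.

(** The set reached from a root [j] is also closed under reversed arcs: a reached vertex other than
    [j] has its only in-neighbour reached, and [j] has none. Hence it fills the weak component. *)
Lemma is_rootE i j : is_root F (weak_component F i) j = tree_root F i j.
Proof.
have [_ indF] := diverging_forestP _ forF.
apply/idP/idP => [/and3P[_ j0 /forall_inP jk]|/andP[j0 ji]].
  by rewrite /tree_root j0 jk // inE connect0.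
have symF : connect_sym [rel x y | arc_rel F x y || arc_rel F y x].
  by apply: sym_connect_sym => x y /=; rewrite orbC.
apply/and3P; split => //.
  rewrite inE symF; apply: connect_sub ji => x y Fxy.
  by apply: connect1; rewrite /= Fxy.
apply/forall_inP => k; rewrite inE.
move=> ik; apply: (connect_closed_ind (P := connect (arc_rel F) j) _ ji ik) => u v /orP[Fuv|Fvu] ju.
  by apply: connect_trans ju _; exact: connect1.
case: (connect_lastP ju) => [eju|[z Fz jz]]; last by rewrite (indF _ _ _ Fvu Fz).
by move/indegree_eq0P/(_ v): j0; rewrite eju [_ \in _]Fvu.
Qed.

End Forest.

(** * Adding an arc to a forest *)

Lemma connect_add F m i x y :
  connect (arc_rel ((m, i) |: F)) x y
  = connect (arc_rel F) x y || connect (arc_rel F) x m && connect (arc_rel F) i y.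
Proof.
have sub : subrel (connect (arc_rel F)) (connect (arc_rel ((m, i) |: F))).
  by apply: connect_sub => u v Fuv; apply: connect1; rewrite arc_relE in_setU1 -arc_relE Fuv orbT.
apply/idP/orP => [|[/sub //|/andP[/sub xm /sub iy]]]; last first.
  apply: connect_trans xm (connect_trans _ iy).
  by apply: connect1; rewrite arc_relE setU11.
(* However often a walk uses the new arc, its parts before the first use and after the last one
   suffice. *)
pose P z := connect (arc_rel F) x z
  \/ connect (arc_rel F) x m && connect (arc_rel F) i z.
apply: (connect_closed_ind (P := P)); last by left; exact: connect0.
move=> u v; rewrite /P; rewrite arc_relE in_setU1 => /orP[/eqP[-> ->]|Fuv].
  by case=> [->|/andP[-> _]]; right; rewrite connect0.
case=> [xu|/andP[xm iu]]; [left|right; rewrite xm];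
  by [apply: connect_trans xu _; exact: connect1
     |apply: connect_trans iu _; exact: connect1].
Qed.

Lemma indegree_add_eq0 F m i j :
  (indegree ((m, i) |: F) j == 0%N) = (j != i) && (indegree F j == 0%N).
Proof.
apply/indegree_eq0P/andP => [H | [ji /indegree_eq0P j0] x].
  split; last by apply/indegree_eq0P => x; have := H x; rewrite in_setU1; case/norP.
  by apply: contraTneq (H m) => ->; rewrite setU11.
by rewrite in_setU1 negb_or j0 andbT xpair_eqE (negPf ji) andbF.
Qed.

Lemma diverging_forest_add F m i : (m, i) \notin F ->
  diverging_forest ((m, i) |: F)
  = [&& diverging_forest F, indegree F i == 0%N & ~~ connect (arc_rel F) i m].
Proof.
move=> nFmi; apply/diverging_forestP/and3P => [[acF indF]|].
  have F'F x y : (x, y) \in F -> (x, y) \in (m, i) |: F.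
    by move=> Fxy; rewrite in_setU1 Fxy orbT.
  split.
  - apply/diverging_forestP; split => [x y /F'F/acF | x y j /F'F Fx /F'F].
      by rewrite connect_add => /norP[].
    exact: indF.
  - apply/indegree_eq0P => x; apply: contra nFmi => Fx.
    by rewrite (indF m x i) ?setU11 ?F'F.
  by have := acF _ _ (setU11 (m, i) F); rewrite connect_add => /norP[].
case=> /diverging_forestP[acF indF] /indegree_eq0P i0 nim; split=> [x y|x y j].
  rewrite connect_add negb_or in_setU1 => /orP[/eqP[-> ->]|Fxy].
    by rewrite nim (negPf nim) andbF.
  (* A circuit through both the old arc [(x, y)] and the new one would contain a walk from [i] to
     [m]. *)
  rewrite acF //=; apply: contra nim => /andP[ym ix].
  by apply: connect_trans ix (connect_trans _ ym); exact: connect1.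
rewrite !in_setU1 => /orP[/eqP[-> ->]|Fx] /orP[/eqP[-> //]|Fy].
- by rewrite (negPf (i0 y)) in Fy.
- by move=> eji; rewrite eji (negPf (i0 x)) in Fx.
exact: indF Fx Fy.
Qed.

(** The tree rooted at [i] is grafted below [m]; nothing changes outside it. *)
Lemma tree_root_add F m i x j :
  diverging_forest F -> indegree F i == 0%N -> ~~ connect (arc_rel F) i m ->
  tree_root ((m, i) |: F) x j
  = if connect (arc_rel F) i x then tree_root F m j else tree_root F x j.
Proof.
move=> forF i0 nim; rewrite /tree_root indegree_add_eq0 connect_add.
have [->|ji] /= := eqVneq j i.
  by case: ifP => [_|->]; rewrite ?(negPf nim) andbF.
case: ifP => ix; last by rewrite andbF orbF.
rewrite andbT; case j0: (indegree F j == 0%N) => //=.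
case jx: (connect (arc_rel F) j x) => //=.
by case/eqP: ji; apply: (tree_root_uniq forF (i := x)); rewrite /tree_root ?j0 ?jx ?i0.
Qed.

Lemma diverging_forest0 : diverging_forest (set0 : {set 'I_n * 'I_n}).
Proof. by apply/diverging_forestP; split => [x y|x y j]; rewrite inE. Qed.

(* A forest in which [i] is not a root is a forest in which [i] is a root,
   together with an arc into [i] from a vertex outside the tree of [i]. *)
Lemma sum_forests_nonroot (V : nmodType) k i (f : {set 'I_n * 'I_n} -> V) :
  \sum_(F | [&& diverging_forest F, #|F| == k & indegree F i != 0%N]) f F
  = \sum_m \sum_(F | [&& diverging_forest F, #|F|.+1 == k, indegree F i == 0%N
                      & ~~ connect (arc_rel F) i m]) f ((m, i) |: F).
Proof.
transitivity (\sum_(F | [&& diverging_forest F, #|F| == k & indegree F i != 0%N])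
                \sum_(m | (m, i) \in F) f F).
  apply: eq_bigr => F /and3P[/diverging_forestP[_ indF] _ /indegree_neq0P[p Fp]].
  by rewrite (big_pred1 p) // => m /=; apply/idP/eqP => [/indF/(_ Fp) | ->].
rewrite (exchange_big_dep xpredT) //=; apply: eq_bigr => m _.
rewrite (reindex_onto (fun F => (m, i) |: F) (fun F => F :\ (m, i))) /=; last first.
  by move=> F /andP[_ Fmi]; rewrite setD1K.
apply: eq_bigl => F; rewrite setU11 andbT.
(* If [F] already contains the arc, removing it does not give back [F], and [i] has positive
   indegree: both conditions fail. *)
have [Fmi|nFmi] := boolP ((m, i) \in F).
  rewrite [_ :\ _ == _](_ : _ = false); last first.
    by apply/eqP => /setP/(_ (m, i)); rewrite setD11 Fmi.
  rewrite andbF; apply/esym/negP => /and4P[_ _ /indegree_eq0P/(_ m)].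
  by rewrite Fmi.
rewrite setU1K // eqxx andbT diverging_forest_add // cardsU1 nFmi indegree_add_eq0.
by rewrite eqxx /= andbT -!andbA; do !bool_congr.
Qed.

End ArcSets.

(** * Weighted forest matrices and their recurrence *)

Section ForestMatrices.
Variables (R : realFieldType) (n : nat) (G : wdigraph R n).
Implicit Types (F : {set 'I_n * 'I_n}).

(** No restriction to subgraphs of [G] is imposed: a forest containing a non-arc has weight 0. This
    lets arcs be added and exchanged freely. *)
Definition forests_weight k : R :=
  \sum_(F : {set 'I_n * 'I_n} | diverging_forest F && (#|F| == k))
     subgraph_weight G F.

Definition forests_mx k : 'M[R]_n :=
  \matrix_(i, j) \sum_(F : {set 'I_n * 'I_n} | diverging_forest F && (#|F| == k))
     subgraph_weight G F * (tree_root F i j)%:R.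

Lemma subgraph_weight_add F m i : (m, i) \notin F ->
  subgraph_weight G ((m, i) |: F) = weight G m i * subgraph_weight G F.
Proof. by move=> nF; rewrite /subgraph_weight big_setU1. Qed.

(** The rows of the Kirchhoff matrix sum to zero, so only differences of rows of [A] survive. *)
Lemma kirchhoff_mulmxE (A : 'M[R]_n) i j :
  (kirchhoff G *m A) i j = \sum_m weight G m i * (A i j - A m j).
Proof.
rewrite mxE (bigD1 i) //= [in RHS](bigD1 i) //= weight_noloop mul0r add0r.
rewrite mxE eqxx /= -sumrN mulr_suml -big_split; apply: eq_bigr => m mi /=.
by rewrite mxE mi opprK mulNr mulrBr.
Qed.

Lemma not_arc_of_root F m i : indegree F i == 0%N -> (m, i) \notin F.
Proof. by move/indegree_eq0P. Qed.

(* Exchanging the arc into [i] from [p] with one from [m] is antisymmetric. *)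
Lemma sum_nonroot_eq0 k i j :
  \sum_m \sum_(F | [&& diverging_forest F, #|F| == k & indegree F i != 0%N])
    weight G m i * (subgraph_weight G F
                    * ((tree_root F i j)%:R - (tree_root F m j)%:R)) = 0 :> R.
Proof.
under eq_bigr do rewrite sum_forests_nonroot.
(* Here [F] has [i] as a root and [(p, i)] is the arc split off, so [i] inherits the root of [p]. *)
pose T F m p := weight G m i * weight G p i * subgraph_weight G F
                * ((tree_root F p j)%:R - (tree_root F m j)%:R) : R.
pose forest_i F := [&& diverging_forest F, #|F|.+1 == k & indegree F i == 0%N].
transitivity (\sum_(F | forest_i F) \sum_(m | ~~ connect (arc_rel F) i m)
               \sum_(p | ~~ connect (arc_rel F) i p) T F m p).
  rewrite exchange_big /=.
  transitivity (\sum_(p < n) \sum_(F | forest_i F && ~~ connect (arc_rel F) i p)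
                 \sum_(m | ~~ connect (arc_rel F) i m) T F m p).
    apply: eq_bigr => p _; rewrite exchange_big /=.
    apply: eq_big => [F|F /and4P[forF _ i0 nip]]; first by rewrite /forest_i -!andbA.
    rewrite [RHS]big_mkcond; apply: eq_bigr => m _.
    rewrite !tree_root_add // connect0 subgraph_weight_add ?not_arc_of_root //.
    (* If [m] lies below [i], both get the root of [p] and the term vanishes. This makes the ranges
       of [m] and [p] equal, as the swap requires. *)
    case: ifP => im /=; first by rewrite subrr !mulr0.
    by rewrite /T !mulrA.
  rewrite (exchange_big_dep forest_i) /=; last by move=> p F _ /andP[].
  apply: eq_bigr => F FF; rewrite [RHS]exchange_big; apply: eq_bigl => p.
  by rewrite FF.
apply: big1 => F _; set S := LHS.
suff: - S = S by move/eqP; rewrite eqNr => /eqP.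
rewrite {2}/S exchange_big -sumrN; apply: eq_bigr => m _.
rewrite -sumrN; apply: eq_bigr => p _.
by rewrite /T -mulrN opprB [weight G p i * _]mulrC.
Qed.

Lemma forests_mx_rec k :
  forests_mx k.+1 = (forests_weight k.+1)%:M - kirchhoff G *m forests_mx k.
Proof.
apply/eqP; rewrite eq_sym subr_eq addrC -subr_eq; apply/eqP/matrixP => i j.
rewrite kirchhoff_mulmxE [LHS]mxE [X in X + _]mxE [X in _ + X]mxE mxE /forests_weight.
rewrite -sumrMnl -sumrN -big_split /=.
(* Where [i] is a root, the identity term and the forest term cancel. The remaining forests have an
   arc into [i] to split off. *)
rewrite (bigID (fun F => indegree F i == 0%N)) /= big1 ?add0r; last first.
  move=> F /andP[_ i0]; rewrite tree_root_source // eq_sym.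
  by rewrite mulr_natr subrr.
under eq_bigl => F do rewrite -andbA.
rewrite sum_forests_nonroot.
transitivity (\sum_m \sum_(F : {set 'I_n * 'I_n} | diverging_forest F && (#|F| == k))
   weight G m i * (subgraph_weight G F
                    * ((tree_root F i j)%:R - (tree_root F m j)%:R)) : R).
  under [RHS]eq_bigr do rewrite (bigID (fun F => indegree F i == 0%N)) /=.
  rewrite [RHS]big_split /=.
  under [X in _ = _ + X]eq_bigr do under eq_bigl do rewrite -andbA.
  rewrite sum_nonroot_eq0 addr0; apply: eq_bigr => m _.
  (* If the root [i] reaches [m], then [i] and [m] share their root and the difference is 0. *)
  rewrite [RHS](bigID (fun F => connect (arc_rel F) i m)) /= [X in _ = X + _]big1.
    rewrite add0r; apply: eq_big => [F|F /and4P[forF _ i0 nim]].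
      by rewrite -!andbA eqSS.
    rewrite subgraph_weight_add ?not_arc_of_root // tree_root_add // connect0.
    rewrite (tree_root_source _ i0) [i == j]eq_sym -[X in X - _]mulr_natr.
    by rewrite !mulrBr !mulrA.
  move=> F /andP[/andP[/andP[forF _] i0] im].
  rewrite tree_root_source //.
  suff -> : tree_root F m j = (j == i) by rewrite subrr !mulr0.
  apply/idP/eqP => [mj|->]; last by rewrite /tree_root i0.
  by apply: (tree_root_uniq forF mj); rewrite /tree_root i0.
apply: eq_bigr => m _; rewrite !mxE -sumrB mulr_sumr; apply: eq_bigr => F _.
by rewrite mulrBr.
Qed.

Lemma forests_mx0 : forests_mx 0 = (forests_weight 0)%:M.
Proof.
apply/matrixP => i j; rewrite !mxE /forests_weight.
rewrite !(big_pred1 set0) => [|F|F]; last 2 first.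
1,2: by rewrite cards_eq0 andb_idl // => /eqP->; exact: diverging_forest0.
rewrite tree_root_source; first by rewrite mulr_natr eq_sym.
by apply/indegree_eq0P => x; rewrite inE.
Qed.

Lemma comm_kirchhoff_forests_mx k :
  kirchhoff G *m forests_mx k = forests_mx k *m kirchhoff G.
Proof.
elim: k => [|k IHk]; first by rewrite forests_mx0 scalar_mxC.
by rewrite forests_mx_rec mulmxBr mulmxBl scalar_mxC {1}IHk mulmxA.
Qed.

(** * Maximum out forests as the end of the recurrence *)

Lemma subgraph_weight_nonarc F : ~~ (F \subset arcs G) -> subgraph_weight G F = 0.
Proof.
case/subsetPn => a Fa; rewrite inE negbK => /eqP a0.
by rewrite /subgraph_weight (bigD1 a) //= a0 mul0r.
Qed.

Lemma subgraph_weight_gt0 F : F \subset arcs G -> 0 < subgraph_weight G F.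
Proof.
move=> /subsetP FG; apply: prodr_gt0 => a /FG; rewrite inE => a0.
by rewrite lt_neqAle eq_sym a0 weight_ge0.
Qed.

(** Here [d] is the size of an out forest that is largest by cardinality. A forest with one arc more
    cannot lie in [arcs G], so its weight is 0. *)
Lemma max_out_forests_card : exists d : nat,
  [/\ forall F, (F \in max_out_forests G) = (F \in out_forests G) && (#|F| == d),
      exists F, F \in max_out_forests G
    & forall F, diverging_forest F -> #|F| = d.+1 -> subgraph_weight G F = 0].
Proof.
have o0 : set0 \in out_forests G by rewrite inE sub0set diverging_forest0.
have [F0 oF0 maxF0] := @arg_maxnP _ set0 (mem (out_forests G)) (fun F => #|F|) o0.
exists #|F0|; split.
- move=> F; rewrite inE; apply: andb_id2l => oF; apply/forall_inP/eqP.
    by move=> maxF; apply/eqP; rewrite eqn_leq (maxF _ oF0) andbT; exact: maxF0.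
  by move=> -> H; exact: maxF0.
- by exists F0; rewrite inE [_ \in _]oF0; apply/forall_inP.
move=> F forF cF; apply: subgraph_weight_nonarc; apply/negP => FG.
have /maxF0 : F \in out_forests G by rewrite inE FG.
by rewrite /= cF ltnn.
Qed.

Lemma Jbar_forests_mx : exists d : nat,
  [/\ forests_weight d != 0, Jbar G = (forests_weight d)^-1 *: forests_mx d,
      forests_weight d.+1 = 0 & forests_mx d.+1 = 0].
Proof.
have [d [mofE [F0 F0m] wt0]] := max_out_forests_card; exists d.
have sumE (f : {set 'I_n * 'I_n} -> R) :
    \sum_(F in max_out_forests G) subgraph_weight G F * f F
    = \sum_(F : {set 'I_n * 'I_n} | diverging_forest F && (#|F| == d))
        subgraph_weight G F * f F.
  rewrite [RHS](bigID (fun F => F \subset arcs G)) /= [X in _ = _ + X]big1.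
    by rewrite addr0; apply: eq_bigl => F; rewrite mofE inE -andbA andbC.
  by move=> F /andP[_ /subgraph_weight_nonarc->]; rewrite mul0r.
have swE : set_weight G (max_out_forests G) = forests_weight d.
  have := sumE (fun=> 1); rewrite /set_weight /forests_weight.
  by under eq_bigr do rewrite mulr1; move=> ->; under eq_bigr do rewrite mulr1.
have arcsm F : F \in max_out_forests G -> F \subset arcs G.
  by rewrite mofE inE -andbA => /and3P[].
split.
- rewrite -swE gt_eqF // /set_weight (bigD1 F0) //= ltr_wpDr //.
    by apply: sumr_ge0 => F /andP[/arcsm/subgraph_weight_gt0/ltW].
  exact/subgraph_weight_gt0/arcsm.
- apply/matrixP => i j; rewrite !mxE swE mulrC; congr (_ * _).
  rewrite -sumE /set_weight [RHS]big_mkcond [LHS]big_mkcond.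
  apply: eq_bigr => F _; rewrite inE; case Fm: (F \in max_out_forests G) => //=.
  have /andP[/setIdP[_ forF] _] : (F \in out_forests G) && (#|F| == d) by rewrite -mofE.
  by rewrite is_rootE // mulr_natr mulrb.
- by apply: big1 => F /andP[forF /eqP /(wt0 _ forF)].
apply/matrixP => i j; rewrite !mxE big1 // => F /andP[forF /eqP /(wt0 _ forF)->].
by rewrite mul0r.
Qed.

Lemma Jbar_kirchhoff : exists M : 'M[R]_n,
  [/\ kirchhoff G *m Jbar G = 0, Jbar G *m kirchhoff G = 0,
      kirchhoff G *m M = 1%:M - Jbar G & M *m kirchhoff G = 1%:M - Jbar G].
Proof.
have [d [s0 JE s1 Q1]] := Jbar_forests_mx.
have LQ : kirchhoff G *m forests_mx d = 0.
  by apply/eqP; rewrite -oppr_eq0 -sub0r -[X in X - _](raddf0 (@scalar_mx R n)) -s1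
     -forests_mx_rec Q1.
have LJ : kirchhoff G *m Jbar G = 0 by rewrite JE -scalemxAr LQ scaler0.
have JL : Jbar G *m kirchhoff G = 0.
  by rewrite JE -scalemxAl -comm_kirchhoff_forests_mx LQ scaler0.
have [N [QE LN]] : exists N, forests_mx d = (forests_weight d)%:M - kirchhoff G *m N
    /\ kirchhoff G *m N = N *m kirchhoff G.
  (* For [d] = 0 there is no preceding matrix, but [forests_mx 0] is scalar, so [N] = 0 works. *)
  case: (d) => [|k].
    by exists 0; rewrite mulmx0 mul0mx subr0 forests_mx0.
  by exists (forests_mx k); rewrite forests_mx_rec comm_kirchhoff_forests_mx.
exists ((forests_weight d)^-1 *: N).
have LM : kirchhoff G *m ((forests_weight d)^-1 *: N) = 1%:M - Jbar G.
  by rewrite JE QE scalerBr scale_scalar_mx mulVf // opprB addrC subrK scalemxAr.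
by split=> //; rewrite -scalemxAl -LN scalemxAr.
Qed.

End ForestMatrices.

(** * The group inverse *)

Lemma group_inverse_uniq (R : realFieldType) n (A X Y : 'M[R]_n) :
  is_group_inverse A X -> is_group_inverse A Y -> X = Y.
Proof.
case=> AXA XAX AX [AYA YAY AY].
(* The product A Y A X reduces to A X, and after commuting both pairs to Y A = A Y. *)
have E : A *m X = A *m Y.
  by rewrite -{1}AYA -mulmxA AX AY -mulmxA (mulmxA A) AXA.
by rewrite -XAX -AX E AY -mulmxA E mulmxA YAY.
Qed.

(** Invertibility is asserted separately because [invmx] returns its argument on singular
    matrices. *)
Theorem theorem11 (R : realFieldType) (n : nat) (hn : (1 < n)%N)
    (G : wdigraph R n) (alpha : R) (halpha : alpha != 0) :
  [/\ kirchhoff G + alpha *: Jbar G \in unitmx,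
      exists X : 'M[R]_n, is_group_inverse (kirchhoff G) X
    & forall X : 'M[R]_n, is_group_inverse (kirchhoff G) X ->
        [/\ X = invmx (kirchhoff G + alpha *: Jbar G) - alpha^-1 *: Jbar G,
            X *m kirchhoff G = 1%:M - Jbar G
          & kirchhoff G *m X = 1%:M - Jbar G]].
Proof.
have [M [LJ JL LM ML]] := Jbar_kirchhoff G.
set L := kirchhoff G in LJ JL LM ML *; set J := Jbar G in LJ JL LM ML *.
have JJ : J *m J = J.
  have : J *m (L *m M) = 0 by rewrite mulmxA JL mul0mx.
  by rewrite LM mulmxBr mulmx1 => /subr0_eq.
pose P := 1%:M - J.
have PJ : P *m J = 0 by rewrite mulmxBl mul1mx JJ subrr.
have JP : J *m P = 0 by rewrite mulmxBr mulmx1 JJ subrr.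
have PP : P *m P = P by rewrite {2}/P mulmxBr mulmx1 PJ subr0.
have LP : L *m P = L by rewrite mulmxBr mulmx1 LJ subr0.
have PL : P *m L = L by rewrite mulmxBl mul1mx JL subr0.
(* [M] inverts [L] only modulo [J]; compressing it by the projection [P] kills its part on the range
   of [J]. *)
pose X := P *m M *m P.
have LX : L *m X = P by rewrite /X !mulmxA LP LM PP.
have XL : X *m L = P by rewrite /X -!mulmxA PL ML PP.
have JX : J *m X = 0 by rewrite /X !mulmxA JP !mul0mx.
have PX : P *m X = X by rewrite mulmxBl mul1mx JX subr0.
have giX : is_group_inverse L X by split; rewrite ?LX ?XL.
(* The ranges of [P] and [J] are complementary: [X] inverts [L] on the first, and [alpha^-1] inverts
   the scalar [alpha] on the second. *)
have inv : (L + alpha *: J) *m (X + alpha^-1 *: J) = 1%:M.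
  rewrite mulmxDl !mulmxDr LX -!scalemxAr LJ -!scalemxAl JX JJ !scaler0 addr0 add0r.
  by rewrite scalerA mulVf // scale1r subrK.
have [U _] := mulmx1_unit inv.
split=> //; first by exists X.
move=> Y /group_inverse_uniq/(_ giX)->; split=> //.
by rewrite -[invmx _]mulmx1 -inv mulKmx // addrK.
Qed.
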